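(* Let $d\ge2$ and let $\mathbf{X}=(X_1,\dots,X_d)$ be a random vector with common marginal distribution $F$, with $F(\gamma)<1$ for all $\gamma$, and with copula $C$. Suppose $C$ is an Archimedean copula with generator $\psi$ such that $\psi^{\leftarrow}$ is twice continuously differentiable and its second derivative is bounded at $0$. Let $E(\gamma)=\sum_{i=1}^d\mathbf{1}\{X_i>\gamma\}$ and consider the estimator of $\alpha(\gamma)=\mathbb{P}(\max_iX_i>\gamma)$ $$\hat\alpha_1(\gamma)=\sum_{i=1}^d\mathbb{P}(X_i>\gamma)+(1-E(\gamma))\,\mathbf{1}\{E(\gamma)\ge2\}.$$ Then $\hat\alpha_1$ has bounded relative error, that is, $\limsup_{\gamma\to\infty}\operatorname{Var}(\hat\alpha_1(\gamma))/\alpha(\gamma)^2<\infty$.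
   Context: Here $\mathbf{1}\{\cdot\}$ denotes the indicator function. A copula $C$ on $[0,1]^d$ is Archimedean with generator $\psi$ if $C(u_1,\dots,u_d)=\psi^{\leftarrow}(\psi(u_1)+\dots+\psi(u_d))$, where $\psi:[0,1]\to[0,\infty]$ is continuous, strictly decreasing and convex with $\psi(1)=0$, and $\psi^{\leftarrow}:[0,\infty)\to[0,1]$ is its (generalized) functional inverse; for instance $\psi$ defines a copula if $\psi^{\leftarrow}$ is the Laplace transform of a non-negative random variable. ''Twice continuously differentiable with second derivative bounded at $0$'' refers to $\psi^{\leftarrow}$ on $(0,\infty)$ and means that $(\psi^{\leftarrow})''$ is bounded on some interval $(0,\delta)$, $\delta>0$. That $\mathbf{X}$ has copula $C$ means $\mathbb{P}(X_1\le x_1,\dots,X_d\le x_d)=C(F(x_1),\dots,F(x_d))$ for all $x_1,\dots,x_d$. *)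

(* Defs.v *)
From mathcomp Require Import all_boot all_order all_algebra.
From mathcomp Require Import all_classical all_reals all_analysis.

Set Implicit Arguments.
Unset Strict Implicit.
Unset Printing Implicit Defensive.

Import Order.TTheory GRing.Theory Num.Theory.
Import numFieldNormedType.Exports.

Local Open Scope classical_set_scope.
Local Open Scope ring_scope.

Section Copulas.
Context {R : realType}.

(* Points of [0,1]^d are functions 'I_d -> R; the values of a copula outside
   the unit cube are irrelevant. *)
Definition unit_cube (d : nat) : set ('I_d -> R) :=
  [set u | forall i, 0 <= u i <= 1].

(* The C-volume of the box with lower corner a and upper corner b; S is the set
   of coordinates in which the vertex agrees with a. *)
Definition box_volume (d : nat) (C : ('I_d -> R) -> R) (a b : 'I_d -> R) : R :=
  \sum_(S : {set 'I_d})
    (-1) ^+ #|S| * C (fun i => if i \in S then a i else b i).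

Definition is_copula (d : nat) (C : ('I_d -> R) -> R) : Prop :=
  [/\ forall u, unit_cube u -> (exists i, u i = 0) -> C u = 0,
      forall u i, unit_cube u -> (forall j, j != i -> u j = 1) -> C u = u i
    & forall a b, unit_cube a -> unit_cube b -> (forall i, a i <= b i) ->
        0 <= box_volume C a b].

(* psi : [0,1] -> [0,+oo]; psi 0 may be +oo, and 0 * +oo = 0 in \bar R. *)
Definition archimedean_generator (psi : R -> \bar R) : Prop :=
  [/\ forall u : R, 0 <= u <= 1 -> (0 <= psi u)%E,
      {within `[0, 1], continuous psi},
      forall u v : R, 0 <= u -> u < v -> v <= 1 -> (psi v < psi u)%E,
      forall u v l : R, 0 <= u <= 1 -> 0 <= v <= 1 -> 0 <= l <= 1 ->
        (psi (l * u + (1 - l) * v)%R <= l%:E * psi u + (1 - l)%:E * psi v)%E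
    & psi 1 = 0%E].

(* For a generator psi this is the inverse of psi on [0, psi 0] and 0 above
   psi 0, including at +oo. *)
Definition generalized_inverse (psi : R -> \bar R) (t : \bar R) : R :=
  inf [set u | 0 <= u <= 1 /\ (psi u <= t)%E].

Definition archimedean_with (d : nat) (C : ('I_d -> R) -> R)
    (psi : R -> \bar R) : Prop :=
  archimedean_generator psi /\
  forall u, unit_cube u ->
    C u = generalized_inverse psi (\sum_(i < d) psi (u i))%E.

(* Only meaningful for open A: the derivatives are taken in the whole line. *)
Definition twice_continuously_differentiable (A : set R) (f : R -> R) : Prop :=
  forall t, A t ->
    [/\ derivable f t 1, derivable (derive1 f) t 1 & {for t, continuous (derive1n 2 f)}].

Definition second_derivative_bounded_at0 (f : R -> R) : Prop :=
  exists2 delta : R, 0 < delta & [bounded derive1n 2 f t | t in `]0, delta[%classic].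

End Copulas.

Section Estimator.
Context {disp : measure_display} {T : measurableType disp} {R : realType}.
Variable P : probability T R.

Definition has_copula (d : nat) (X : 'I_d -> T -> R) (F : R -> R)
    (C : ('I_d -> R) -> R) : Prop :=
  forall x : 'I_d -> R,
    P [set w | forall i, X i w <= x i] = (C (fun i => F (x i)))%:E.

Definition exceedances (d : nat) (X : 'I_d -> T -> R) (gamma : R) (w : T) : R :=
  \sum_(i < d) \1_[set w' | gamma < X i w'] w.

Definition max_tail (d : nat) (X : 'I_d -> T -> R) (gamma : R) : \bar R :=
  P [set w | (gamma%:E < \big[maxe/-oo]_(i < d) (X i w)%:E)%E].

Definition alpha1_hat (d : nat) (X : 'I_d -> T -> R) (gamma : R) (w : T) : R :=
  \sum_(i < d) fine (P [set w' | gamma < X i w']) +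
  (1 - exceedances X gamma w) * \1_[set w' | 2 <= exceedances X gamma w'] w.

Definition bounded_relative_error (est : R -> T -> R) (alpha : R -> \bar R)
    : Prop :=
  (limf_esup (fun gamma => 'V_P[est gamma] / alpha gamma ^+ 2)
     (pinfty_nbhs R) < +oo)%E.

End Estimator.

(* Main.v *)
Require Import Defs.
From mathcomp Require Import all_boot all_order all_algebra.
From mathcomp Require Import all_classical all_reals all_analysis.
From mathcomp Require Import measurable_realfun.
From mathcomp Require Import ring lra.

Set Implicit Arguments.
Unset Strict Implicit.
Unset Printing Implicit Defensive.

Import Order.TTheory GRing.Theory Num.Theory.
Import numFieldNormedType.Exports.

Local Open Scope classical_set_scope.
Local Open Scope ring_scope.

(* Let p = P(X_i > gamma) and phi be the generalized inverse of psi. The second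
   term of the estimator is bounded by 1 + d and vanishes unless two coordinates
   exceed gamma, so its variance is at most (1 + d)^2 times a sum of pair
   probabilities P(X_i > gamma, X_j > gamma), while alpha(gamma) >= p. With
   t = psi(1 - p), such a pair probability is the second difference
   phi(0) - 2 phi(t) + phi(2t) = O(t^2), because phi'' is bounded near 0; and
   t = O(p), because psi is convex with psi(1) = 0. *)

(** * Second differences of twice differentiable functions *)

Section SecondDifference.
Context {R : realType}.

(** The mean value theorem on [[0, t]] and [[t, 2t]] writes the second difference as
    [(f' c2 - f' c1) * t]; applied again to [f'], it gives [f'' c3 * (c2 - c1) * t], where
    [c2 - c1 < 2 * t]. At 0 the assumption is a right limit, since a generalized inverse is 0 at
    negative arguments and 1 at 0. *)
Lemma second_difference_le (f : R -> R) (M delta t : R) :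
  (forall x : R, 0 < x -> derivable f x 1) ->
  (forall x : R, 0 < x -> derivable (derive1 f) x 1) ->
  (forall x : R, 0 < x < delta -> `|derive1n 2 f x| <= M) ->
  f x @[x --> 0^'+] --> f 0 ->
  0 < t -> 2 * t < delta ->
  f 0 - 2 * f t + f (2 * t) <= 2 * M * t ^+ 2.
Proof.
move=> df ddf bf cf0 t0 tdelta.
have fE (x : R) : 0 < x -> is_derive x 1 f (derive1 f x).
  by move=> /df dfx; rewrite derive1E; exact: derivableP.
have ffE (x : R) : 0 < x -> is_derive x 1 (derive1 f) (derive1n 2 f x).
  by move=> /ddf dfx; rewrite derive1nS /= derive1E; exact: derivableP.
have cf (x : R) : 0 < x -> {for x, continuous f}.
  by move=> /df dfx; apply: differentiable_continuous; exact/derivable1_diffP.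
have [|||c1 /[!in_itv]/= /andP[c10 c1t] E1] := @MVT R f (derive1 f) 0 t => //.
- by move=> x /[!in_itv]/= /andP[x0 _]; exact: fE.
- apply/continuous_within_itvP => //; split => //.
  + by move=> x /[!in_itv]/= /andP[x0 _]; exact: cf.
  + by apply: cvg_at_left_filter; exact: cf.
have [|||c2 /[!in_itv]/= /andP[c2t c22t] E2] := @MVT R f (derive1 f) t (2 * t).
- lra.
- by move=> x /[!in_itv]/= /andP[x0 _]; apply: fE; lra.
- apply: derivable_within_continuous => x /[!in_itv]/= /andP[x0 _].
  by apply: df; lra.
have [|||c3 /[!in_itv]/= /andP[c31 c32] E3] :=
    @MVT R (derive1 f) (derive1n 2 f) c1 c2.
- lra.
- by move=> x /[!in_itv]/= /andP[x0 _]; apply: ffE; lra.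
- apply: derivable_within_continuous => x /[!in_itv]/= /andP[x0 _].
  by apply: ddf; lra.
have c3M : `|derive1n 2 f c3| <= M by apply: bf; lra.
have -> : f 0 - 2 * f t + f (2 * t) = derive1n 2 f c3 * (c2 - c1) * t.
  by rewrite -E3; lra.
have Hle : derive1n 2 f c3 <= M by exact: le_trans (ler_norm _) c3M.
have M0 : 0 <= M by exact: le_trans c3M.
(* This product and the next add up to the right-hand side minus the left-hand side. *)
have : (M - derive1n 2 f c3) * (c2 - c1) * t >= 0.
  by rewrite !mulr_ge0//; lra.
have : M * (2 * t - (c2 - c1)) * t >= 0 by rewrite !mulr_ge0//; lra.
lra.
Qed.

End SecondDifference.

(** * Archimedean generators near 1 and their inverses near 0 *)

Section Generator.
Context {R : realType} (psi : R -> \bar R).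
Hypothesis hpsi : archimedean_generator psi.

Local Notation phi := (generalized_inverse psi).

Let psi_ge0 u : 0 <= u <= 1 -> (0 <= psi u)%E.
Proof. by case: hpsi => + _ _ _ _; apply. Qed.

Let psi_lt u v : 0 <= u -> u < v -> v <= 1 -> (psi v < psi u)%E.
Proof. by case: hpsi => _ _ + _ _; apply. Qed.

Let psi1 : psi 1 = 0%E. Proof. by case: hpsi. Qed.

Lemma generator_fin_num q : 0 < q <= 1 -> psi q \is a fin_num.
Proof.
move=> /andP[q0 q1]; rewrite ge0_fin_numE; last by apply: psi_ge0; lra.
by apply: (lt_le_trans (psi_lt (lexx 0) q0 q1)); exact: leey.
Qed.

(** By convexity and [psi 1 = 0], the graph lies below its chord over [[1/2, 1]]. The chord starts
    at 1/2 and not at 0, where [psi] may be infinite. *)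
Lemma generator_le_linear :
  exists2 K, 0 < K & forall q, 1 / 2 <= q <= 1 -> (psi q <= (K * (1 - q))%:E)%E.
Proof.
have h01 : 0 < (1 / 2 : R) <= 1 by lra.
have hfin := generator_fin_num h01.
have hpos : (0 < psi (1 / 2))%E by rewrite -psi1; apply: psi_lt; lra.
exists (2 * fine (psi (1 / 2))).
  by apply: mulr_gt0 => //; apply: fine_gt0; rewrite hpos -ge0_fin_numE// ltW.
move=> q /andP[q2 q1].
have [_ _ _ cvx _] := hpsi.
(* The weight [2 * (1 - q)] makes [q] a convex combination of 1/2 and 1. *)
have := @cvx (1 / 2) 1 (2 * (1 - q)).
rewrite psi1 mule0 adde0 -[X in (_ * X)%E](fineK hfin) -EFinM.
rewrite (_ : _ * (1 / 2) + _ = q); last by lra.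
by move=> /(_ ltac:(lra) ltac:(lra) ltac:(lra)); congr (_ <= _%:E)%E; ring.
Qed.

Let preimage_neq0 t : (0 <= t)%E ->
  [set u | 0 <= u <= 1 /\ (psi u <= t)%E] !=set0.
Proof. by move=> t0; exists 1 => /=; rewrite ler01 lexx psi1. Qed.

Let preimage_lbound t : has_lbound [set u | 0 <= u <= 1 /\ (psi u <= t)%E].
Proof. by exists 0 => u /= [/andP[]]. Qed.

Lemma generalized_inverse_le1 t : (0 <= t)%E -> phi t <= 1.
Proof.
by move=> t0; apply: ge_inf => //=; rewrite ler01 lexx psi1.
Qed.

Lemma generalized_inverse_nonincreasing s t : (0 <= s)%E -> (s <= t)%E ->
  phi t <= phi s.
Proof.
move=> s0 st; apply: lb_le_inf; first exact: preimage_neq0.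
by move=> u /= [u01 us]; apply: ge_inf => //=; split => //; exact: le_trans st.
Qed.

(** Points [u < q] satisfy [psi u > psi q >= s], so they lie outside the set whose infimum is
    [phi s]. *)
Lemma generalized_inverse_ge q s : 0 <= q <= 1 -> (0 <= s <= psi q)%E ->
  q <= phi s.
Proof.
move=> /andP[q0 q1] /andP[s0 sq]; apply: lb_le_inf; first exact: preimage_neq0.
move=> u /= [/andP[u0 u1] us]; rewrite leNgt; apply/negP => uq.
by have := psi_lt u0 uq q1; rewrite ltNge (le_trans us sq).
Qed.

Lemma generatorK q : 0 <= q <= 1 -> phi (psi q) = q.
Proof.
move=> q01; apply/eqP; rewrite eq_le; apply/andP; split.
  by apply: ge_inf => //=; split.
by apply: generalized_inverse_ge => //; rewrite lexx psi_ge0.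
Qed.

Lemma generalized_inverse0 : phi 0%E = 1.
Proof. by rewrite -psi1 generatorK// ler01 lexx. Qed.

(** For [q < 1] close to 1, [psi q > 0] and every [t] in []0, psi q[] satisfies
    [q <= phi t <= 1]. *)
Lemma generalized_inverse_cvg0 : phi t%:E @[t --> 0^'+] --> phi 0%E.
Proof.
rewrite generalized_inverse0; apply/cvgrPdist_le => e e0.
(* The floor 1/2 keeps [q] positive and hence [psi q] finite. *)
pose q := Num.max (1 - e) (1 / 2).
have q1 : q < 1 by rewrite /q gt_max; lra.
have qe : 1 - e <= q by rewrite /q le_max lexx.
have q2 : 1 / 2 <= q by rewrite /q le_max lexx orbT.
have hq : 0 < q <= 1 by lra.
have pos : 0 < fine (psi q).
  have h : (0 < psi q)%E by rewrite -psi1; apply: psi_lt; lra.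
  by apply: fine_gt0; rewrite h -ge0_fin_numE ?generator_fin_num// ltW.
near=> t.
have t0 : 0 < t by near: t; exact: nbhs_right_gt.
have tq : t < fine (psi q) by near: t; exact: nbhs_right_lt.
have h1 : phi t%:E <= 1 by apply: generalized_inverse_le1; rewrite lee_fin ltW.
have h2 : q <= phi t%:E.
  apply: generalized_inverse_ge; first by lra.
  by rewrite lee_fin ltW//= -(fineK (generator_fin_num hq)) lee_fin ltW.
by rewrite ger0_norm; lra.
Unshelve. all: by end_near. Qed.

(** The left-hand side is the second difference of [phi] with step [psi q], as [phi 0 = 1] and
    [phi (psi q) = q]. Its last term is the value of the copula at a point with two coordinates [q]
    and the others 1. *)
Lemma diagonal_tail_quadratic :
  twice_continuously_differentiable `]0, +oo[ (fun t => phi t%:E) ->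
  second_derivative_bounded_at0 (fun t => phi t%:E) ->
  exists K eps, [/\ 0 < K, 0 < eps <= 1 / 2 & forall q, 1 - eps < q < 1 ->
    1 - 2 * q + phi (psi q + psi q)%E <= K * (1 - q) ^+ 2].
Proof.
move=> C2 [delta delta0 [M [_ bM]]].
have [L L0 psiL] := generator_le_linear.
(* The hypothesis [bM] gives the bounds strictly above [M], hence [|M| + 1]. In [eps], 1/2 gives
   access to the linear bound on [psi], and [delta / (2 * L)] ensures [2 * t < delta] for
   [t = psi q]. *)
exists (2 * (`|M| + 1) * L ^+ 2), (Num.min (1 / 2) (delta / (2 * L))).
have Lp : 0 < delta / (2 * L) by rewrite divr_gt0// mulr_gt0.
split.
- by rewrite !mulr_gt0//= ?exprn_gt0// ltr_wpDl.
- by rewrite lt_min Lp ge_min lexx andbT; lra.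
move=> q /andP[qe q1].
have q2 : 1 / 2 <= q.
  have : Num.min (1 / 2) (delta / (2 * L)) <= 1 / 2 by rewrite ge_min lexx.
  by lra.
have qd : L * (1 - q) < delta / 2.
  have : 1 - q < delta / (2 * L).
    have : Num.min (1 / 2) (delta / (2 * L)) <= delta / (2 * L).
      by rewrite ge_min lexx orbT.
    lra.
  rewrite ltr_pdivlMr ?mulr_gt0//; lra.
have hq : 0 < q <= 1 by lra.
have q01 : 0 <= q <= 1 by lra.
have pE := fineK (generator_fin_num hq).
set t := fine (psi q) in pE.
have t0 : 0 < t.
  by have := @psi_lt q 1; rewrite psi1 -pE lte_fin; apply; lra.
have tL : t <= L * (1 - q) by rewrite -lee_fin pE; apply: psiL; lra.
rewrite -pE -EFinD (_ : t + t = 2 * t); last by ring.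
have -> : 1 - 2 * q = phi 0%E - 2 * phi t%:E.
  by rewrite generalized_inverse0 pE generatorK.
have C2' (x : R) : 0 < x -> `]0, +oo[%classic x by move=> x0; rewrite /= in_itv/= x0.
apply: le_trans (@second_difference_le _ (fun t => phi t%:E) (`|M| + 1) delta t
  _ _ _ _ t0 _) _.
- by move=> x /C2' /C2 [].
- by move=> x /C2' /C2 [].
- move=> x xd; apply: (bM (`|M| + 1)) => //=.
  by rewrite (le_lt_trans (ler_norm M))// ltrDl.
- exact: generalized_inverse_cvg0.
- lra.
rewrite -!mulrA ler_pM2l// ler_pM2l; last by rewrite ltr_wpDl.
rewrite mulrA -expr2 -exprMn lerXn2r// nnegrE ltW//.
exact: lt_le_trans tL.
Qed.

End Generator.

(** * Union bound, inclusion-exclusion and variance of bounded variables *)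

Section Measure.
Context d (T : measurableType d) (R : realType).
Local Open Scope ereal_scope.

(** The union bound over a filtered list, by induction: once [A i] is removed from [B], the
    remaining list covers the rest. *)
Lemma measure_le_sum (mu : {measure set T -> \bar R}) (I : eqType) (r : seq I)
    (Q : pred I) (A : I -> set T) (B : set T) :
  measurable B -> (forall i, measurable (A i)) ->
  (forall w, B w -> exists i, [/\ i \in r, Q i & A i w]) ->
  mu B <= \sum_(i <- r | Q i) mu (A i).
Proof.
elim: r B => [|i r IHr] B mB mA BA.
  rewrite big_nil (_ : B = set0) ?measure0//.
  by apply/seteqP; split => // w /BA[i []].
have mBi : measurable (B `\` A i) by exact: measurableD.
rewrite big_cons; case: ifPn => Qi.
  apply: (@le_trans _ _ (mu (A i `|` B `\` A i))).
    rewrite le_measure ?inE//; first exact: measurableU.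
    by move=> w Bw; have [|] := pselect (A i w); [left|right].
  apply: (le_trans (measureU2 _ _ _)) => //; apply: leeD2l.
  apply: IHr => // w [/BA [j [+ Qj Aj]] Ai].
  by rewrite in_cons => /predU1P[ji|jr]; [rewrite ji in Aj|exists j].
apply: IHr => // w /BA [j [+ Qj Aj]].
by rewrite in_cons => /predU1P[ji|jr]; [rewrite -ji Qj in Qi|exists j].
Qed.

Variable P : probability T R.

Lemma probability_setCI (A B : set T) : measurable A -> measurable B ->
  P (~` A `&` ~` B) = 1 - P A - P B + P (A `&` B).
Proof.
move=> mA mB.
rewrite -setCU probability_setC; last exact: measurableU.
have -> : P (A `|` B) = P A + P B - P (A `&` B).
  by apply: measureUfinl => //; rewrite (le_lt_trans (probability_le1 _ _)) ?ltry.
have mAB : measurable (A `&` B) by exact: measurableI.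
rewrite -(fineK (fin_num_measure P A mA)) -(fineK (fin_num_measure P B mB)).
rewrite -(fineK (fin_num_measure P _ mAB)) -!(EFinB, EFinD). 
by congr (_%:E); ring.
Qed.

Lemma Lfun2_bounded (Y : T -> R) (M : R) : measurable_fun setT Y ->
  (forall w, (`|Y w| <= M)%R) -> Y \in Lfun P 2%:E.
Proof.
move=> mY bY; rewrite inE/=; apply/andP; split; rewrite inE//=.
rewrite /finite_norm unlock poweR_lty//.
apply: (@le_lt_trans _ _ (\int[P]_x (cst (M `^ 2)%:E x))).
  apply: ge0_le_integral => //=.
  - apply/measurable_EFinP; apply: (measurableT_comp (measurable_powR _)).
    exact: measurableT_comp.
  - move=> x _; rewrite lee_fin ge0_ler_powR// nnegrE//.
    exact: le_trans (bY x).
by rewrite integral_cst//= probability_setT mule1 ltry.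
Qed.

(** The shift by [c] leaves the variance unchanged, and [Var Y <= E[Y^2]], where [Y^2 <= M^2] on [A]
    and [Y = 0] off [A]. *)
Lemma variance_cstD_le (c M : R) (Y : T -> R) (A : set T) :
  measurable A -> measurable_fun setT Y -> (forall w, (`|Y w| <= M)%R) ->
  (forall w, ~ A w -> Y w = 0%R) ->
  'V_P[(cst c \+ Y)%R] <= (M ^+ 2)%:E * P A.
Proof.
move=> mA mY bY Y0.
have LY := Lfun2_bounded mY bY.
rewrite varianceD_cst_l// varianceE//.
apply: (@le_trans _ _ 'E_P[Y ^+ 2]).
  by rewrite leeBlDr ?fin_numX ?expectation_fin_num ?Lfun_subset12
     ?fin_num_measure// leeDl// expe2 sqre_ge0.
have L1A : (\1_A : T -> R) \in Lfun P 1.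
  apply: Lfun_subset12; first by rewrite fin_num_measure.
  apply: (@Lfun2_bounded _ 1) => //.
  by move=> w; rewrite indicE; case: (_ \in _); rewrite ?normr1 ?normr0.
rewrite -expectation_indic// -expectationZl//.
apply: expectation_le => //.
- exact: (measurable_funX 2 mY).
- exact: measurable_funM.
- by move=> w; exact: sqr_ge0.
- by move=> w; rewrite /= mulr_ge0 ?sqr_ge0.
- apply: aeW => w /=; rewrite -[(Y ^+ 2)%R w]/(Y w ^+ 2)%R indicE.
  have [/[!inE] Aw|] := boolP (w \in A).
    rewrite mul1r -real_normK ?num_real// lerXn2r// ?nnegrE//.
    exact: (le_trans _ (bY w)).
  by rewrite notin_setE => /Y0 ->; rewrite expr0n mul0r.
Qed.

End Measure.

(** * Exceedance counts and the tail of the maximum *)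

Section Exceedances.
Context {disp : measure_display} {T : measurableType disp} {R : realType}.
Variables (P : probability T R) (d : nat) (X : 'I_d -> {RV P >-> R}).

Let XT : 'I_d -> T -> R := fun i => X i.

Lemma measurable_tail i x : measurable [set w | x < X i w].
Proof.
rewrite -[[set _ | _]]setTI (_ : [set w | _] = X i @^-1` `]x, +oo[%classic).
  exact: (measurable_funPT (X i)).
by apply/seteqP; split => w /=; rewrite in_itv/= andbT.
Qed.

Lemma tail_setC i x : [set w | x < X i w] = ~` [set w | X i w <= x].
Proof.
by apply/seteqP; split => w /=; [rewrite ltNge => /negP|move/negP; rewrite -ltNge].
Qed.

Lemma measurable_sublevel i x : measurable [set w | X i w <= x].
Proof.
rewrite -[X in measurable X]setCK -tail_setC.
by apply: measurableC; exact: measurable_tail.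
Qed.

Lemma measurable_exceedances gamma : measurable_fun setT (exceedances XT gamma).
Proof.
by apply: measurable_sum => i; apply: measurable_indic; exact: measurable_tail.
Qed.

Lemma exceedances_ge0 gamma w : 0 <= exceedances XT gamma w.
Proof. by apply: sumr_ge0 => i _; rewrite indicE. Qed.

Lemma exceedances_le gamma w : exceedances XT gamma w <= d%:R.
Proof.
rewrite -[d in leRHS]card_ord -sum1_card natr_sum.
by apply: ler_sum => i _; rewrite indicE ler_nat leq_b1.
Qed.

(** Failing such a pair, at most one indicator in the sum is nonzero. *)
Lemma exceedances_ge2 gamma w : 2 <= exceedances XT gamma w ->
  exists i j, [/\ i != j, gamma < X i w & gamma < X j w].
Proof.
apply: contraPP => noij; apply/negP; rewrite -ltNge.
have [[i iw]|noi] := pselect (exists i, gamma < X i w); last first.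
  rewrite /exceedances big1 ?ltr0n// => i _.
  by rewrite indicE memNset// => iw; apply: noi; exists i.
rewrite /exceedances (bigD1 i)//= big1.
  by rewrite addr0 indicE ltr_nat ltnS leq_b1.
move=> j ji; rewrite indicE memNset// => jw; apply: noij.
by exists i, j; split => //; rewrite eq_sym.
Qed.

Lemma measurable_exceedances_ge2 gamma :
  measurable [set w | 2 <= exceedances XT gamma w].
Proof.
rewrite -[[set _ | _]]setTI.
rewrite (_ : [set w | _] = exceedances XT gamma @^-1` `[2, +oo[%classic).
  exact: measurable_exceedances.
by apply/seteqP; split => w /=; rewrite in_itv/= andbT.
Qed.

Lemma variance_alpha1_hat_le gamma :
  ('V_P[alpha1_hat P XT gamma] <=
    ((1 + d%:R) ^+ 2)%:E * P [set w | (2 <= exceedances XT gamma w)%R])%E.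
Proof.
apply: (@variance_cstD_le _ _ _ _ _ _
  (fun w => (1 - exceedances XT gamma w) *
     \1_[set w' | 2 <= exceedances XT gamma w'] w)).
- exact: measurable_exceedances_ge2.
- apply: measurable_funM.
    by apply: measurable_funB => //; exact: measurable_exceedances.
  by apply: measurable_indic; exact: measurable_exceedances_ge2.
- move=> w; rewrite normrM (le_trans (ler_piMr _ _))//.
    by rewrite indicE; case: (_ \in _); rewrite ?normr1 ?normr0.
  rewrite (le_trans (ler_normB _ _))// normr1 lerD2l.
  by rewrite ger0_norm ?exceedances_ge0// exceedances_le.
- by move=> w Aw; rewrite indicE memNset// mulr0.
Qed.

(** The maximum exceeds [gamma] exactly on the union of the events [gamma < X j]. The lower bound
    controls the denominator of the relative error; the upper bound makes it finite. *)
Lemma max_tail_bounds gamma i :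
  (P [set w | (gamma < X i w)%R] <= max_tail P XT gamma <= 1)%E.
Proof.
rewrite /max_tail.
have -> : [set w | (gamma%:E < \big[maxe/-oo]_(i < d) (XT i w)%:E)%E] =
    \bigcup_(j in [set: 'I_d]) [set w | gamma < X j w].
  apply/seteqP; split => w /=.
    (* The initial value [-oo] of the maximum never exceeds [gamma]. *)
    move=> /bigmax_gtP[|[j _]]; first by rewrite ltNge leNye.
    by rewrite lte_fin => jw; exists j.
  by move=> [j _ jw]; apply/bigmax_gtP; right; exists j => //; rewrite lte_fin.
have mU : measurable (\bigcup_(j in [set: 'I_d]) [set w | gamma < X j w]).
  by apply: fin_bigcup_measurable => // j _; exact: measurable_tail.
rewrite probability_le1// andbT; apply: le_measure; rewrite ?inE//.
  exact: measurable_tail.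
by move=> w iw; exists i.
Qed.

(** * Marginal and joint tails under the Archimedean copula *)

Variable F : R -> R.
Hypothesis hF : forall i x, cdf (X i) x = (F x)%:E.

Lemma probability_le i x : P [set w | X i w <= x] = (F x)%:E.
Proof.
by rewrite -(hF i) /cdf /distribution/= /pushforward set_itvNyc.
Qed.

Lemma probability_gt i x : P [set w | x < X i w] = (1 - F x)%:E.
Proof.
rewrite tail_setC probability_setC ?probability_le//.
exact: measurable_sublevel.
Qed.

Variables (C : ('I_d -> R) -> R) (psi : R -> \bar R).
Hypothesis hXC : has_copula P XT F C.
Hypothesis hpsi : archimedean_with C psi.

(* By inclusion-exclusion, it suffices to bound [P(X_i <= gamma, X_j <= gamma)].
   The coordinates other than [i] and [j] are capped at a large [x], at the cost
   of [d * (1 - F x)]; this avoids the bivariate margins of [C]. *)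
Lemma joint_tail_le i j gamma x : i != j -> gamma <= x ->
  (P [set w | (gamma < X i w)%R /\ (gamma < X j w)%R] <=
    (1 - 2 * F gamma + generalized_inverse psi (psi (F gamma) + psi (F gamma))
      + d%:R * (1 - F x))%:E)%E.
Proof.
move=> ij gx.
have mA := measurable_sublevel.
have F01 y : 0 <= F y <= 1 by rewrite -!lee_fin -(hF i) cdf_ge0 cdf_le1.
have [gen archC] := hpsi.
have psi_ge0 y : (0 <= psi (F y))%E by case: gen => + _ _ _ _; apply.
have -> : [set w | gamma < X i w /\ gamma < X j w] =
    ~` [set w | X i w <= gamma] `&` ~` [set w | X j w <= gamma].
  by rewrite -!tail_setC.
rewrite probability_setCI// !probability_le.
pose y k := if (k == i) || (k == j) then gamma else x.
(* [None] indexes the box below [y], and [Some k] the event that coordinate [k] overshoots [x];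
   together they cover the event that [X i] and [X j] are both at most [gamma]. *)
pose A k := if k is Some k then [set w | x < X k w]
            else [set w | forall k, X k w <= y k].
have mall : measurable [set w | forall k, X k w <= y k].
  rewrite (_ : [set w | _] = \bigcap_(k in [set: 'I_d]) [set w | X k w <= y k]).
    by apply: fin_bigcap_measurable.
  by apply/seteqP; split => w /= h k; [move=> _|]; exact: h.
have cover : (P ([set w | (X i w <= gamma)%R] `&` [set w | (X j w <= gamma)%R]) <=
    (generalized_inverse psi (psi (F gamma) + psi (F gamma))
       + d%:R * (1 - F x))%:E)%E.
  apply: (le_trans (@measure_le_sum _ _ _ P (option 'I_d)
    (None :: [seq Some k | k <- enum 'I_d]) xpredT A _ _ _ _)).
  - exact: measurableI.
  - by case => [k|] //=; exact: measurable_tail.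
  - move=> w /= [iw jw].
    have [[k kx]|nok] := pselect (exists k, x < X k w).
      by exists (Some k); rewrite in_cons map_f// mem_enum.
    exists None; split => // k /=.
    rewrite /y; have [->//|_] := eqVneq k i; have [->//|_] := eqVneq k j.
    by rewrite leNgt; apply/negP => kx; apply: nok; exists k.
  rewrite big_cons big_map big_enum/= EFinD leeD//.
    rewrite (hXC y) lee_fin archC; last by move=> k; exact: F01.
    (* Cutting the generator sum down to its terms [i] and [j], both equal to [psi (F gamma)], can
       only increase its image under the inverse. *)
    apply: generalized_inverse_nonincreasing => //; first exact: adde_ge0.
    rewrite (bigD1 i)//= (bigD1 j)/=; last by rewrite eq_sym.
    rewrite /y !eqxx orbT addeA leeDl//.
    by apply: sume_ge0 => k _; exact: psi_ge0.
  under eq_bigr do rewrite probability_gt.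
  by rewrite sumEFin lee_fin sumr_const card_ord mulr_natl.
rewrite -EFinB.
by apply: (le_trans (leeD (lexx _) cover)); rewrite -EFinD lee_fin; lra.
Qed.

Lemma cdf_eventually_gt (i : 'I_d) e : 0 < e -> \forall x \near +oo, 1 - e < F x.
Proof.
move=> e0; have := cvg_cdfy1 (X i).
rewrite (_ : cdf (X i) = EFin \o F); last by apply/funext => x /=; rewrite hF.
move=> /fine_cvgP[_] /cvgrPdist_lt /(_ _ e0).
apply: filterS => x /=; rewrite ltr_norml => /andP[_ ]; lra.
Qed.

End Exceedances.

(** * Bounded relative error *)

Theorem corollary2 (disp : measure_display) (T : measurableType disp)
    (R : realType) (P : probability T R) (d : nat) (hd : (2 <= d)%N)
    (X : 'I_d -> {RV P >-> R}) (F : R -> R)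
    (hF : forall i x, cdf (X i) x = (F x)%:E)
    (hF1 : forall gamma, F gamma < 1)
    (C : ('I_d -> R) -> R) (hC : is_copula C)
    (hXC : has_copula P (fun i => X i : T -> R) F C)
    (psi : R -> \bar R) (hpsi : archimedean_with C psi)
    (hC2 : twice_continuously_differentiable `]0, +oo[
             (fun t => generalized_inverse psi t%:E))
    (hbd : second_derivative_bounded_at0
             (fun t => generalized_inverse psi t%:E)) :
  bounded_relative_error P
    (alpha1_hat P (fun i => X i : T -> R))
    (max_tail P (fun i => X i : T -> R)).
Proof.
have [gen _] := hpsi.
have [K [eps [K0 /andP[eps0 eps2] tail]]] := diagonal_tail_quadratic gen hC2 hbd.
pose i0 : 'I_d := Ordinal (ltnW hd).
(* The factors bound the squared random term, the number of ordered pairs, and a pair probability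
   divided by [p ^+ 2]: [K] from the second difference, [d] from the capping. *)
pose D : R := (1 + d%:R) ^+ 2 * ((d * d)%:R * (K + d%:R)).
pose V := [set gamma | 1 - eps < F gamma].
have VF : pinfty_nbhs R V := cdf_eventually_gt hF i0 eps0.
apply: (@le_lt_trans _ _ D%:E); last exact: ltry.
(* The upper limit is an infimum of suprema over neighbourhoods of [+oo], so a uniform bound on [V]
   suffices. *)
apply: le_trans (ereal_inf_lbound _) _; first by exists V.
apply: ge_ereal_sup => _ [gamma Vg <-].
have p0 : 0 < 1 - F gamma by have := hF1 gamma; lra.
set p := 1 - F gamma in p0.
(* The cap [x] depends on [gamma]: it is taken so far out that [1 - F x < p ^+ 2], and capping costs
   at most [d * p ^+ 2]. *)
have [x [gx Fx]] : exists x, gamma <= x /\ 1 - p ^+ 2 < F x.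
  have p20 : 0 < p ^+ 2 by rewrite exprn_gt0.
  have /filter_ex[x xP] : \forall x \near +oo, gamma <= x /\ 1 - p ^+ 2 < F x.
    apply: filterI; first exact: nbhs_pinfty_ge (num_real gamma).
    exact: (cdf_eventually_gt hF i0 p20).
  by exists x.
pose pair (ij : 'I_d * 'I_d) := [set w | gamma < X ij.1 w /\ gamma < X ij.2 w].
have mpair ij : measurable (pair ij).
  by apply: measurableI; exact: measurable_tail.
have pair_le ij : ij.1 != ij.2 -> (P (pair ij) <= ((K + d%:R) * p ^+ 2)%:E)%E.
  move=> nij; apply: (le_trans (joint_tail_le hF hXC hpsi nij gx)).
  rewrite lee_fin [leRHS]mulrDl lerD//; first by apply: tail; rewrite Vg/=; exact: hF1.
  by rewrite ler_wpM2l//; lra.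
have E2 : (P [set w | (2 <= exceedances (fun i => X i : T -> R) gamma w)%R] <=
    ((d * d)%:R * (K + d%:R) * p ^+ 2)%:E)%E.
  apply: (le_trans (@measure_le_sum _ _ _ P _
    (enum {: 'I_d * 'I_d}) (fun ij => ij.1 != ij.2) pair _ _ _ _)) => //.
  - exact: measurable_exceedances_ge2.
  - move=> w /exceedances_ge2 [i [j [ij iw jw]]].
    by exists (i, j); rewrite mem_enum.
  (* Diagonal pairs are added back at the same nonnegative bound, so that the count is [d * d]. *)
  apply: (@le_trans _ _ (\sum_(ij <- enum {: 'I_d * 'I_d})
    ((K + d%:R) * p ^+ 2)%:E)%E).
    rewrite big_mkcond/=; apply: lee_sum => ij _.
    case: ifPn => [/pair_le|_] //; rewrite lee_fin.
    by rewrite mulr_ge0 ?sqr_ge0// addr_ge0// ltW.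
  rewrite big_enum/= sumEFin sumr_const card_prod !card_ord.
  by rewrite lee_fin -[leLHS]mulr_natl mulrA.
have /andP[tail_ge tail_le] := max_tail_bounds X gamma i0.
rewrite (probability_gt hF) -/p in tail_ge.
(* Being finite and at least [p > 0], the denominator turns the extended quotient into an inequality
   between products. *)
have afin : max_tail P (fun i => X i : T -> R) gamma \is a fin_num.
  by rewrite fin_numE gt_eqF ?lt_eqF//= ?(le_lt_trans tail_le) ?ltry//
    (lt_le_trans _ tail_ge)// ltNyr.
move: tail_ge; rewrite -(fineK afin) lee_fin; set a := fine _ => pa.
have a0 : 0 < a by exact: lt_le_trans pa.
rewrite -EFin_expe inver sqrf_eq0 gt_eqF// lee_pdivrMr ?exprn_gt0//.
apply: (le_trans (variance_alpha1_hat_le X gamma)).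
apply: (@le_trans _ _ (D * p ^+ 2)%:E).
  by rewrite /D -[X in (_ <= X%:E)%E]mulrA [leRHS]EFinM lee_wpmul2l// lee_fin sqr_ge0.
rewrite -EFinM lee_fin ler_wpM2l//; last by rewrite lerXn2r// nnegrE ltW.
by rewrite !mulr_ge0// ?sqr_ge0// addr_ge0// ltW.
Qed.
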